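(* Let $R$ be a polynomial ring over a field and let $I$ be a monomial ideal in $R$ such that either $I$ is squarefree, or for every variable $x\in R$ we have $d_x(M)=d_x(I)$ for every monomial $M\in\mathcal{G}(I)$ such that $x\mid M$. Then for all $n\ge 1$, $I^{[n]}$ has no embedded associated primes (that is, $R/I^{[n]}$ has no embedded associated primes).
   Context: For a monomial ideal $I$, $\mathcal{G}(I)$ denotes its set of (minimal) monomial generators. For a variable $x$ and a monomial $M$, $d_x(M)$ is the degree of $x$ in $M$, and $d_x(I)=\max\{d_x(M)\mid M\in\mathcal{G}(I)\}$. For $n\ge1$, $I^{[n]}=\langle M^n\mid M\in\mathcal{G}(I)\rangle$ is the ideal generated by the $n$-th powers of the monomial generators of $I$. An associated prime is embedded if it is not minimal. *)

(* Defs.v *)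
From HB Require Import structures.
From mathcomp Require Import all_boot all_order all_algebra.
From mathcomp Require Import boolp classical_sets fsbigop.
From mathcomp Require Import mpoly.

Set Implicit Arguments.
Unset Strict Implicit.
Unset Printing Implicit Defensive.

Import GRing.Theory.

Local Open Scope classical_set_scope.
Local Open Scope ring_scope.

Section Ideals.
Variable R : comNzRingType.
Implicit Types J P Q G : set R.

(* [idealr_closed] of the library forces an ideal to be proper, whereas here
   the unit ideal is allowed: an ideal is a submodule of R over itself. *)
Definition is_ideal J : Prop := @submod_closed R R^o (mem J).

Definition ideal_gen G : set R := smallest is_ideal G.

(* Primes are proper: [idealr_closed] includes [1 \notin P]. *)
Definition prime_ideal P : Prop :=
  idealr_closed (mem P) /\ prime_idealr_closed (mem P).

(* The annihilator of the class of f in R/J. *)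
Definition annihilator_mod J (f : R) : set R := [set g | J (g * f)].

(* P is an associated prime of the R-module R/J. *)
Definition associated_prime J P : Prop :=
  prime_ideal P /\ exists f : R, P = annihilator_mod J f.

Definition embedded_prime J P : Prop :=
  associated_prime J P /\ exists2 Q, associated_prime J Q & Q `<` P.

End Ideals.

(* Monomials are represented by their exponent vectors u : 'X_{1..m}; the
   degree of the i-th variable in 'X_[u] is u i. *)
Section MonomialIdeals.
Variables (K : fieldType) (m : nat).
Implicit Types (I : set {mpoly K[m]}) (E : set 'X_{1..m}).

Definition mon_ideal E : set {mpoly K[m]} := ideal_gen [set 'X_[u] | u in E].

Definition monomial_ideal I : Prop := exists E, I = mon_ideal E.

Definition minimal_generators I E : Prop :=
  mon_ideal E = I /\ forall E', E' `<=` E -> mon_ideal E' = I -> E' = E.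

(* The minimal set of monomial generators of I, which exists and is unique
   whenever I is a monomial ideal (minimal_generatorsP, mingensP). *)
Definition mingens I : set 'X_{1..m} := xget set0 (minimal_generators I).

(* The library's maximum over a set is 0 when infinitely many indices have a
   nonzero value; this does not arise, as a monomial ideal is finitely
   generated. *)
Definition max_deg I (i : 'I_m) : nat := \big[maxn/0%N]_(u \in mingens I) u i.

Definition squarefree_ideal I : Prop :=
  forall u, mingens I u -> forall i : 'I_m, (u i <= 1)%N.

Definition pow_ideal I (n : nat) : set {mpoly K[m]} :=
  ideal_gen [set ('X_[u] : {mpoly K[m]}) ^+ n | u in mingens I].

Lemma mem_mon_ideal E (u : 'X_{1..m}) :
  mon_ideal E 'X_[u] <-> exists2 e, E e & (e <= u)%MM.
Proof.
split=> [|[e Ee le_eu]]; last first.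
  move=> J [[J0 Jlin] sEJ]; rewrite -(submK le_eu) mpolyXD.
  have XJ : ('X_[e] : {mpoly K[m]}) \in mem J by apply/mem_set/sEJ; exists e.
  by have := Jlin 'X_[u - e] _ _ XJ J0; rewrite addr0 => /set_mem.
pose J := [set f : {mpoly K[m]} |
  forall v, v \in msupp f -> exists2 e, E e & (e <= v)%MM].
have JI : is_ideal J.
  split=> [|a f g]; first by apply/mem_set => v; rewrite msupp0.
  rewrite -[a *: f]/((a : {mpoly K[m]}) * f) => /set_mem Jf /set_mem Jg.
  apply/mem_set => v /msuppD_le.
  rewrite mem_cat => /orP[/msuppM_le avf|]; last exact: Jg.
  have [[v1 v2] /= [_ v2f ->]] := allpairsP avf.
  have [e Ee le_e] := Jf _ v2f; exists e => //.
  by apply: lepm_trans le_e _; rewrite addmC lem_addr.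
suff sEJ : mon_ideal E `<=` J by move=> /sEJ; apply; rewrite msuppX mem_seq1.
apply: smallest_sub => // _ [e Ee <-] v; rewrite msuppX mem_seq1 => /eqP->.
by exists e => //; exact: lepm_refl.
Qed.

Lemma mon_ideal_is_ideal E : is_ideal (mon_ideal E).
Proof.
split=> [|a f g /set_mem Ef /set_mem Eg]; apply/mem_set => J JI.
  by have [[/set_mem]] := JI.
have [[_ Jlin] _] := JI; apply/set_mem/Jlin; apply/mem_set; [exact: Ef|exact: Eg].
Qed.

Lemma mon_ideal_sub E E' :
    (forall u, E u -> exists2 e, E' e & (e <= u)%MM) ->
  mon_ideal E `<=` mon_ideal E'.
Proof.
move=> EE'; apply: smallest_sub; first exact: mon_ideal_is_ideal.
by move=> _ [u Eu <-]; apply/mem_mon_ideal/EE'.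
Qed.

Lemma minimal_generatorsP I E : monomial_ideal I ->
  minimal_generators I E <->
  E = [set u | I 'X_[u] /\ forall v, I 'X_[v] -> (v <= u)%MM -> v = u].
Proof.
case=> E0 ->; set M := [set u | _]; pose I0 := mon_ideal E0.
have MI E1 : mon_ideal E1 = I0 -> M `<=` E1.
  move=> defI u [Iu minu].
  have : mon_ideal E1 'X_[u] by rewrite defI.
  case/mem_mon_ideal => e E1e le_eu; suff <- : e = u by [].
  by apply: minu => //; rewrite -/I0 -defI; apply/mem_mon_ideal; exists e => //; exact: lepm_refl.
have genM : mon_ideal M = I0.
  apply/seteqP; split; apply: mon_ideal_sub => u; first by case=> /mem_mon_ideal.
  move=> E0u; have {E0u} : I0 'X_[u].
    by apply/mem_mon_ideal; exists u => //; exact: lepm_refl.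
  have [n] := ubnP (mdeg u); elim: n u => // n IHn u ltn Iu.
  have [Mu|/not_andP[//|/existsNP[v /not_implyP[Iv /not_implyP[le_vu ne_vu]]]]]
    := pselect (M u); first by exists u => //; exact: lepm_refl.
  have lt_vu : (mdeg v < mdeg u)%N.
    rewrite -(submK le_vu) mdegD -[ltnLHS]add0n ltn_add2r lt0n mdeg_eq0.
    by apply/eqP => uv0; apply: ne_vu; rewrite -(submK le_vu) uv0 add0m.
  have [|//|e Me le_ev] := IHn v; first by apply: leq_trans lt_vu _; rewrite -ltnS.
  by exists e => //; apply: lepm_trans le_ev le_vu.
split=> [[genE minE]|->]; first by rewrite -(minE M) //; apply: MI.
by split=> // E' sE'M genE'; apply/seteqP; split=> //; apply: MI.
Qed.

Lemma mingensP I : monomial_ideal I -> minimal_generators I (mingens I).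
Proof.
by move=> monI; apply: xgetPex; eexists; apply/minimal_generatorsP.
Qed.

End MonomialIdeals.

(* Main.v *)
Require Import Defs.
From HB Require Import structures.
From mathcomp Require Import all_boot all_order all_algebra.
From mathcomp Require Import boolp classical_sets fsbigop.
From mathcomp Require Import mpoly.

(** In the minimal generators of [I] every variable occurs with exponent 0 or
    with one fixed positive exponent, and raising them to the n-th power
    preserves this.  So let [J] be an ideal generated by monomials in which
    the nonzero exponents of [x_i] all equal [D i].  It behaves like a squarefree
    ideal, with [x_i ^ D i] in place of [x_i].  Call a set T of variables a cover
    if each generator of [J] involves a variable of T.  Then [J] is the
    intersection, over the minimal covers T, of the primary ideals
    [q_T = (x_i ^ D i : i in T)], with radicals [p_T = (x_i : i in T)]
    ([pure_power_ideal_superset] and [pure_power_ideal_separation]).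

    Let Q be contained in P = (J : f), with P and Q both associated primes.
    The set T of the variables lying in Q is a cover, since Q is a prime
    containing [J].  As f is not in [J], some minimal cover T0 has f outside
    [q_T0].  For i in T, the product [x_i * f] is in [J], hence in [q_T0],
    which forces i to be in T0; so T = T0 by minimality.  Finally let h be in
    P.  Reducing h modulo [p_T], contained in Q, and f modulo [q_T], one gets
    h0 and f0 with [h0 * f0] in [q_T]; the leading monomial of this product is
    the product of one without variables of T and one outside [q_T], so that
    it cannot be in [q_T] and h0 = 0.  Hence P = Q. *)

Set Implicit Arguments.
Unset Strict Implicit.
Unset Printing Implicit Defensive.

Import GRing.Theory.

Local Open Scope classical_set_scope.
Local Open Scope ring_scope.

(** * Ideals and primes *)

Section Ideals.
Variable R : comNzRingType.
Implicit Types (J P : set R) (f g : R).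

Lemma is_idealMl J f g : is_ideal J -> J g -> J (f * g).
Proof.
case=> J0 Jlin Jg.
by have := Jlin f _ _ (mem_set Jg) J0; rewrite addr0 => /set_mem.
Qed.

Lemma is_idealD J f g : is_ideal J -> J f -> J g -> J (f + g).
Proof.
case=> _ Jlin Jf Jg.
by have := Jlin 1 _ _ (mem_set Jf) (mem_set Jg); rewrite scale1r => /set_mem.
Qed.

Lemma is_idealB J f g : is_ideal J -> J f -> J g -> J (f - g).
Proof.
by move=> idJ Jf Jg; apply: is_idealD => //; rewrite -mulN1r; apply: is_idealMl.
Qed.

Lemma is_ideal_sum J (I : Type) (r : seq I) (a : pred I) (F : I -> R) :
  is_ideal J -> (forall i, a i -> J (F i)) -> J (\sum_(i <- r | a i) F i).
Proof.
move=> idJ JF; apply: (big_ind J) => //; last by move=> f g; apply: is_idealD.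
by case: idJ => /set_mem.
Qed.

Lemma prime_is_ideal P : prime_ideal P -> is_ideal P.
Proof. by case=> [[P0 _ Plin] _]; split. Qed.

Lemma prime_proper P : prime_ideal P -> ~ P 1.
Proof. by case=> [[_ /negP P1 _] _] /mem_set. Qed.

Lemma prime_mul P f g : prime_ideal P -> P (f * g) -> P f \/ P g.
Proof.
by case=> _ Ppr /mem_set /Ppr /orP[] /set_mem; [left | right].
Qed.

Lemma prime_exp P f k : prime_ideal P -> P (f ^+ k) -> k != 0%N /\ P f.
Proof.
move=> Ppr; elim: k => [|k IHk]; first by rewrite expr0 => /(prime_proper Ppr).
by rewrite exprS => /(prime_mul Ppr)[//|/IHk[]].
Qed.

Lemma prime_prod P (I : Type) (r : seq I) (F : I -> R) :
  prime_ideal P -> P (\prod_(i <- r) F i) -> exists i, P (F i).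
Proof.
move=> Ppr; elim: r => [|i r IHr]; first by rewrite big_nil => /(prime_proper Ppr).
by rewrite big_cons => /(prime_mul Ppr)[PFi|//]; exists i.
Qed.

Lemma sub_annihilator_mod J f : is_ideal J -> J `<=` annihilator_mod J f.
Proof. by move=> idJ g Jg; rewrite /annihilator_mod /= mulrC; apply: is_idealMl. Qed.

End Ideals.

(** * Monomial ideals *)

Section MonomialIdeals.
Variables (K : fieldType) (m : nat).
Implicit Types (E : set 'X_{1..m}) (f g h : {mpoly K[m]}) (u v e : 'X_{1..m}).

Lemma prime_monomial (P : set {mpoly K[m]}) u :
  prime_ideal P -> P 'X_[u] -> exists2 i, u i != 0%N & P 'X_i.
Proof.
move=> Ppr; rewrite mpolyXE_id => /(prime_prod Ppr)[i].
by move=> /(prime_exp Ppr)[ui0 PXi]; exists i.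
Qed.

(** A polynomial is the combination of its monomials, and conversely the
    polynomials all of whose monomials are multiples of elements of [E] form an
    ideal. *)
Lemma mon_idealP E f :
  mon_ideal E f <-> forall v, v \in msupp f -> exists2 e, E e & (e <= v)%MM.
Proof.
have idE := @mon_ideal_is_ideal K m E.
split=> [|Ef]; last first.
  rewrite [f]mpolyE big_seq; apply: is_ideal_sum => // v /Ef Ev.
  rewrite -mul_mpolyC; apply: (is_idealMl _ idE).
  exact/mem_mon_ideal.
pose J := [set g : {mpoly K[m]} |
  forall v, v \in msupp g -> exists2 e, E e & (e <= v)%MM].
have JI : is_ideal J.
  split=> [|a g h]; first by apply/mem_set => v; rewrite msupp0.
  rewrite -[a *: g]/((a : {mpoly K[m]}) * g) => /set_mem Jg /set_mem Jh.
  apply/mem_set => v /msuppD_le.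
  rewrite mem_cat => /orP[/msuppM_le avg|]; last exact: Jh.
  have [[v1 v2] /= [_ v2g ->]] := allpairsP avg.
  have [e Ee le_e] := Jg _ v2g; exists e => //.
  by apply: lepm_trans le_e _; rewrite addmC lem_addr.
suff sEJ : mon_ideal E `<=` J by move=> /sEJ.
apply: smallest_sub => // _ [e Ee <-] v; rewrite msuppX mem_seq1 => /eqP->.
by exists e => //; apply: lepm_refl.
Qed.

(** Normal form modulo a monomial ideal: discard the monomials of [f] that lie
    in it. *)
Lemma mon_ideal_reduce E f : exists2 g, mon_ideal E (f - g) &
  forall v, v \in msupp g -> ~ mon_ideal E ('X_[v] : {mpoly K[m]}).
Proof.
pose a v := `[< mon_ideal E ('X_[v] : {mpoly K[m]}) >].
exists (\sum_(v <- msupp f | ~~ a v) f@_v *: 'X_[v]).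
  rewrite {1}[f]mpolyE (bigID a) /= addrK.
  have idE := @mon_ideal_is_ideal K m E.
  apply: is_ideal_sum => // v /asboolP Ev; rewrite -mul_mpolyC.
  exact: (is_idealMl _ idE).
move=> v; rewrite mcoeff_msupp raddf_sum /= => nz_v.
have /hasP[w wf /andP[Naw]] :
    has (fun w => ~~ a w && (w == v)) (msupp f).
  apply: contraNT nz_v => /hasPn/= NE; apply/eqP/big1_seq => w /andP[Naw wf].
  by have := NE w wf; rewrite Naw mcoeffZ mcoeffX /= => /negPf->; rewrite mulr0.
by move/eqP=> <- Ew; case/asboolP: Naw.
Qed.

End MonomialIdeals.

(** * Ideals generated by pure powers of variables *)

Section PurePowers.
Variables (K : fieldType) (m : nat).
Implicit Types (D : 'I_m -> nat) (T : {set 'I_m}) (f g h : {mpoly K[m]}).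

Definition pure_power_ideal D T : set {mpoly K[m]} :=
  mon_ideal [set (U_(i) *+ D i)%MM | i in [set` T]].

Lemma lem_mulmU (i : 'I_m) k (u : 'X_{1..m}) : (U_(i) *+ k <= u)%MM = (k <= u i)%N.
Proof.
apply/mnm_lepP/idP => [/(_ i)|le_k j]; first by rewrite mulmnE mnm1E eqxx mul1n.
by rewrite mulmnE mnm1E; case: eqP => [<-|_]; rewrite ?mul1n ?mul0n.
Qed.

Lemma pure_power_idealP D T f : pure_power_ideal D T f <->
  forall u, u \in msupp f -> exists2 i, i \in T & (D i <= u i)%N.
Proof.
rewrite /pure_power_ideal mon_idealP; split=> Tf u /Tf.
  by case=> _ [i Ti <-]; rewrite lem_mulmU; exists i.
by case=> i Ti le_i; exists (U_(i) *+ D i)%MM; [exists i | rewrite lem_mulmU].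
Qed.

Lemma pure_power_idealX D T (u : 'X_{1..m}) :
  pure_power_ideal D T 'X_[u] <-> exists2 i, i \in T & (D i <= u i)%N.
Proof.
rewrite pure_power_idealP; split=> [|Tu v]; first by apply; rewrite msuppX mem_seq1.
by rewrite msuppX mem_seq1 => /eqP->.
Qed.

Lemma pure_power_ideal_sub D T (J : set {mpoly K[m]}) : is_ideal J ->
  (forall i, i \in T -> J ('X_i ^+ D i)) -> pure_power_ideal D T `<=` J.
Proof.
move=> idJ JT; apply: smallest_sub => // _ [_ [i Ti <-] <-].
by rewrite -mpolyXn; apply: JT.
Qed.

(** Multiplication by a variable outside [T] does not change the exponents that
    membership in the ideal depends on. *)
Lemma pure_power_ideal_mulX D T f i :
  i \notin T -> pure_power_ideal D T ('X_i * f) -> pure_power_ideal D T f.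
Proof.
move=> Ti /pure_power_idealP Tif; apply/pure_power_idealP => u uf.
have [|j Tj] := Tif (U_(i) + u)%MM.
  by rewrite mcoeff_msupp [_ * f]mulrC mcoeffMX -mcoeff_msupp.
rewrite mnmDE mnm1E; case: eqP => [eq_ij|_]; last by exists j.
by rewrite eq_ij Tj in Ti.
Qed.

(** The product of two nonzero reduced polynomials has a leading monomial
    with the same exponents on [T] as the leading monomial of the second. *)
Lemma pure_power_ideal_reduced_mul D T h f :
    (forall u, u \in msupp h -> forall i, i \in T -> u i = 0%N) ->
    (forall u, u \in msupp f -> forall i, i \in T -> (u i < D i)%N) ->
  f != 0 -> pure_power_ideal D T (h * f) -> h = 0.
Proof.
move=> hT fT nz_f /pure_power_idealP Thf; apply/eqP/negPn/negP => nz_h.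
have [|i Ti] := Thf (mlead h + mlead f)%MM.
  by rewrite -mleadM // mlead_supp // mulf_neq0.
by rewrite mnmDE hT ?mlead_supp // add0n leqNgt fT ?mlead_supp.
Qed.

(** * Ideals whose generators have fixed exponents *)

Variables (E : set 'X_{1..m}) (D : 'I_m -> nat).

(** The covers [T] are the sets for which the prime [(x_i : i in T)] contains
    the ideal of [E]; the minimal ones give its minimal primes. *)
Definition is_cover T : bool :=
  `[< forall e, E e -> exists2 i, i \in T & e i != 0%N >].

Hypothesis E_D : forall e, E e -> forall i, e i != 0%N -> e i = D i.

Lemma pure_power_ideal_superset T :
  is_cover T -> mon_ideal E `<=` pure_power_ideal D T.
Proof.
move=> /asboolP covT; apply: mon_ideal_sub => e Ee.
have [i Ti ei0] := covT e Ee; exists (U_(i) *+ D i)%MM; first by exists i.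
by rewrite lem_mulmU (E_D Ee ei0).
Qed.

(** If a monomial [u] of [f] is not in the ideal of [E], then the variables whose
    exponent in [u] is less than [D] form a cover; any minimal cover among
    them works. *)
Lemma pure_power_ideal_separation f : ~ mon_ideal E f ->
  exists2 T, minset is_cover T & ~ pure_power_ideal D T f.
Proof.
rewrite mon_idealP => /existsNP[u /not_implyP[uf Nu]].
have covA : is_cover [set i : 'I_m | (u i < D i)%N]%SET.
  apply/asboolP => e Ee.
  have /existsNP[i /negP] : ~ forall i, (e i <= u i)%N.
    by move=> /mnm_lepP le_eu; apply: Nu; exists e.
  rewrite -ltnNge => lt_ue; have ei0 : e i != 0%N by rewrite -lt0n (leq_ltn_trans _ lt_ue).
  by exists i => //; rewrite inE -(E_D Ee ei0).
have [T minT sTA] := minset_exists covA.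
exists T => // /pure_power_idealP /(_ u uf)[i Ti].
by rewrite leqNgt; have := fintype.subsetP sTA i Ti; rewrite inE => ->.
Qed.

(** Since Q is contained in P, the variables in Q lie in the radical of every
    primary component of the ideal that avoids f; minimality of the cover then
    leaves no variables but those of Q, and P is generated by them. *)
Theorem fixed_exponents_no_embedded_prime (P : set {mpoly K[m]}) :
  ~ embedded_prime (mon_ideal E) P.
Proof.
have idJ := mon_ideal_is_ideal K E.
case=> [[Ppr [f defP]]] [Q [Qpr [g defQ]] [sQP]]; apply.
have [idP idQ] := (prime_is_ideal Ppr, prime_is_ideal Qpr).
have P_f h : P h <-> mon_ideal E (h * f) by rewrite defP.
have NJf : ~ mon_ideal E f.
  by move=> Jf; apply: (prime_proper Ppr); apply/P_f; rewrite mul1r.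
pose T := [set i : 'I_m | `[< Q 'X_i >]]%SET.
have TE i : (i \in T) <-> Q 'X_i by rewrite inE; split=> /asboolP.
have covT : is_cover T.
  apply/asboolP => e Ee.
  have Qe : Q 'X_[e].
    rewrite defQ; apply: (sub_annihilator_mod g idJ).
    by apply/mem_mon_ideal; exists e; last exact: lepm_refl.
  by have [i ei0 /TE Ti] := prime_monomial Qpr Qe; exists i.
have [T0 /minsetP[covT0 minT0] Nf] := pure_power_ideal_separation NJf.
have {minT0} eqT : T = T0.
  apply: minT0 => //; apply/fintype.subsetP => i /TE /sQP /P_f.
  move=> /(pure_power_ideal_superset covT0) qXf; apply: contra_notT Nf => T0i.
  exact: pure_power_ideal_mulX qXf.
rewrite -{T0}eqT in Nf {covT0}.
move=> h Ph.
(* The prime (x_i : i in T) is the pure power ideal with all exponents 1. *)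
have [h0 ph h0T] := mon_ideal_reduce [set (U_(i) *+ 1)%MM | i in [set` T]] h.
have Qh : Q (h - h0).
  by apply: pure_power_ideal_sub ph => // i /TE; rewrite expr1.
have [f0 qf f0T] := mon_ideal_reduce [set (U_(i) *+ D i)%MM | i in [set` T]] f.
suff h00 : h0 = 0 by rewrite h00 subr0 in Qh.
apply: (@pure_power_ideal_reduced_mul D T h0 f0).
- move=> u /h0T NTu i Ti; apply/eqP; rewrite -leqn0 leqNgt; apply/negP => ui.
  by apply: NTu; apply/(pure_power_idealX (fun=> 1%N)); exists i.
- move=> u /f0T NTu i Ti; rewrite ltnNge; apply/negP => le_i.
  by apply: NTu; apply/pure_power_idealX; exists i.
- by apply: contra_notN Nf => /eqP f00; rewrite f00 subr0 in qf.
have idq : is_ideal (pure_power_ideal D T) by apply: mon_ideal_is_ideal.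
have -> : h0 * f0 = h0 * f - h0 * (f - f0) by rewrite mulrBr opprB addrC subrK.
apply: (is_idealB idq); last exact: (is_idealMl _ idq).
apply: (pure_power_ideal_superset covT); apply/P_f.
have -> : h0 = h - (h - h0) by rewrite opprB addrC subrK.
by apply: (is_idealB idP) => //; apply: sQP.
Qed.

End PurePowers.

Lemma pow_idealE (K : fieldType) (m : nat) (I : set {mpoly K[m]}) n :
  pow_ideal I n = mon_ideal [set (u *+ n)%MM | u in mingens I].
Proof.
rewrite /mon_ideal image_comp; congr ideal_gen.
by apply: eq_imagel => u _; rewrite /= mpolyXn.
Qed.

Theorem corollary2p15 (K : fieldType) (m : nat) (I : set {mpoly K[m]})
    (monI : monomial_ideal I)
    (hI : squarefree_ideal I \/
          forall i : 'I_m, forall u : 'X_{1..m}, mingens I u ->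
            (U_(i) <= u)%MM -> u i = max_deg I i)
    (n : nat) (n_ge1 : (1 <= n)%N) :
  forall P : set {mpoly K[m]}, ~ embedded_prime (pow_ideal I n) P.
Proof.
move=> P; rewrite pow_idealE.
have [d dP] : exists d : 'I_m -> nat,
    forall u, mingens I u -> forall i, u i != 0%N -> u i = d i.
  case: hI => [sqI | degI].
    exists (fun=> 1%N) => u Iu i; rewrite -lt0n => ui_gt0.
    by apply/eqP; rewrite eqn_leq ui_gt0 sqI.
  exists (max_deg I) => u Iu i; rewrite -lt0n => ui_gt0.
  by apply: degI => //; rewrite -[U_(i)%MM]mulm1n lem_mulmU.
apply: (@fixed_exponents_no_embedded_prime K m _ (fun i => d i * n)%N).
move=> _ [u Iu <-] i; rewrite mulmnE muln_eq0 negb_or => /andP[ui0 _].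
by rewrite (dP u Iu i ui0).
Qed.
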